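(* $f\mathcal{N}(\mathrm{Fin})\subseteq f\mathcal{S}(\mathrm{Fin})$, and both $f\mathcal{N}(\mathrm{Fin})$ and $f\mathcal{S}(\mathrm{Fin})$ are $\sigma$-ideals of subsets of $\omega^\omega$.
   Context: $\exists^\infty n$ means ''for infinitely many $n\in\omega$''. A subset $F\subseteq\omega^\omega$ belongs to $f\mathcal{N}(\mathrm{Fin})$ if there is a sequence $(S_n)_{n\in\omega}$ of finite sets $S_n\subseteq\omega^n$ such that $F\subseteq\{x\in\omega^\omega:(\exists^\infty n)(x\upharpoonright n\in S_n)\}$. A subset $F\subseteq\omega^\omega$ belongs to $f\mathcal{S}(\mathrm{Fin})$ if there are a partition $(I_n)_{n\in\omega}$ of $\omega$ into (nonempty, finite) intervals and a sequence $(J_n)_{n\in\omega}$ of finite sets $J_n\subseteq\omega^{I_n}$ such that $F\subseteq\{x\in\omega^\omega:(\exists^\infty n)(x\upharpoonright I_n\in J_n)\}$. *)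

(* Defs.v *)
From mathcomp Require Import all_boot.
From mathcomp Require Import boolp classical_sets functions cardinality.

Set Implicit Arguments.
Unset Strict Implicit.
Unset Printing Implicit Defensive.

Local Open Scope classical_set_scope.

Definition inf_often (P : nat -> Prop) : Prop := infinite_set [set n | P n].

Definition nat_interval (A : set nat) : Prop :=
  forall i j k, A i -> A k -> i <= j <= k -> A j.

(* No monotonicity of the enumeration I is required. *)
Definition interval_partition (I : nat -> set nat) : Prop :=
  partition setT I setT /\ forall n, finite_set (I n) /\ nat_interval (I n).

(* The set `I_n = {0, ..., n - 1} plays the role of the ordinal n; a set A of
   naturals is used as a type in A -> nat, and sigL A x is the restriction of x
   to A. *)
Definition fN_Fin : set (set (nat -> nat)) :=
  [set F | exists S : forall n : nat, set (`I_n -> nat),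
    (forall n, finite_set (S n)) /\
    F `<=` [set x | inf_often (fun n => S n (sigL `I_n x))]].

Definition fS_Fin : set (set (nat -> nat)) :=
  [set F | exists (I : nat -> set nat) (J : forall n : nat, set (I n -> nat)),
    [/\ interval_partition I,
        forall n, finite_set (J n) &
        F `<=` [set x | inf_often (fun n => J n (sigL (I n) x))]]].

(* As usual in set theory, an ideal is proper: X itself is not a member. *)
Definition sigma_ideal (X : Type) (K : set (set X)) : Prop :=
  [/\ K set0,
      ~ K setT,
      forall A B : set X, A `<=` B -> K B -> K A &
      forall A : nat -> set X, (forall n, K (A n)) -> K (\bigcup_n A n)].

(* Main.v *)
Require Import Defs.
From mathcomp Require Import all_boot.
From mathcomp Require Import boolp classical_sets functions cardinality.

(** The family [fS_Fin] has a description without partitions: [F] belongs to it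
    iff some [h : nat -> nat] satisfies [x m <= h m] for infinitely many [m],
    for every [x] in [F] ([fS_FinP]).  If the restriction of [x] to a block
    lies in a finite set of functions, then at each point [m] of the block the
    value [x m] lies in a finite set of naturals, hence below a bound [h m] that
    depends only on [m]; distinct blocks provide distinct [m].  Conversely,
    such an [h] is a condition on the partition into singletons.

    With this description, [fS_Fin] is proper because [h + 1] is nowhere below
    [h], and it is closed under countable unions because countably many bounds
    [h_i] are all eventually dominated by one function, namely
    [m |-> max_(i <= m) h_i m].  The inclusion of [fN_Fin] in [fS_Fin] is the
    same remark on bounds: if the restriction of [x] to [m + 1] lies in a finite
    set, then [x m] is bounded.  It also gives properness of [fN_Fin].
    Countable unions in [fN_Fin] are handled by the same diagonal trick, with
    the finite sets [S_0 n, ..., S_n n] joined at level [n]. *)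

Local Open Scope classical_set_scope.

(** Infinitude is transported through any relabelling [f] of the indices because
    finite sets have finite images; the finitely many [n < i] do not count. *)
Lemma inf_often_relabel (f : nat -> nat) (i : nat) (P Q : nat -> Prop) :
  (forall n, i <= n -> P n -> exists2 m, Q m & f m = n) ->
  inf_often P -> inf_often Q.
Proof.
move=> PQ infP finQ; apply: infP.
apply: (@sub_finite_set _ _ (`I_i `|` f @` [set m | Q m])).
  move=> n /= Pn; have [ltni|lein] := ltnP n i; first by left.
  by right; have [m Qm fm] := PQ n lein Pn; exists m.
by rewrite finite_setU; split; [exact: finite_II | exact: finite_image].
Qed.

Lemma inf_often_eventually (i : nat) (P Q : nat -> Prop) :
  (forall n, i <= n -> P n -> Q n) -> inf_often P -> inf_often Q.
Proof.
by move=> PQ; apply: (@inf_often_relabel id i) => n lein Pn; exists n; auto.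
Qed.

Lemma finite_restriction_bound (U : Type) (A : set U) (J : set (A -> nat))
    (u : U) : finite_set J -> A u ->
  exists b, forall x : U -> nat, J (sigL A x) -> x u <= b.
Proof.
move=> finJ Au; pose v : A := SigSub (mem_set Au).
have /finite_seqP[l lE] := finite_image (fun s : A -> nat => s v) finJ.
exists (\max_(k <- l) k) => x Jx.
apply: (@leq_bigmax_seq _ _ xpredT id) => //.
suff: [set` l] (x u) by [].
by rewrite -lE; exists (sigL A x).
Qed.

Lemma singletons_interval_partition : interval_partition (fun n => [set n]).
Proof.
split.
  split.
  - by apply/seteqP; split=> // n _; exists n.
  - by move=> i j _ _ [k [/= <- <-]].
  - by move=> n _; exists n.
move=> n; split; first exact: finite_set1.
by move=> i j k /= -> -> /andP[nj jn]; apply/eqP; rewrite eqn_leq jn nj.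
Qed.

Lemma fS_FinP (F : set (nat -> nat)) :
  fS_Fin F <->
  exists h : nat -> nat, F `<=` [set x | inf_often (fun m => x m <= h m)].
Proof.
split=> [[I [J [[[covI trivI neI] _] finJ FJ]]]|[h Fh]].
  have /choice[N IN] m : exists n, I n m.
    have : cover setT I m by rewrite covI.
    by move=> [n _ Inm]; exists n.
  have /choice[h hP] m := finite_restriction_bound _ _ _ _ (finJ (N m)) (IN m).
  exists h => x /FJ; apply: (@inf_often_relabel N 0) => n _ Jn.
  have [m Im] := neI n Logic.I.
  have Nm : N m = n by apply: trivI => //; exists m; split; [exact: IN|].
  by exists m => //; apply: hP; rewrite Nm.
(* A function on a singleton is constant, so the bound leaves finitely many. *)
exists (fun n => [set n]),
  (fun n => (fun c (_ : [set n]) => c) @` `I_(h n).+1).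
split; [exact: singletons_interval_partition | |].
  by move=> n; apply: finite_image; exact: finite_II.
move=> x /Fh; apply: (@inf_often_eventually 0) => n _ xh.
exists (x n) => //; apply: funext => -[k kn] /=.
by rewrite set_valE /=; move: kn; rewrite inE /= => ->.
Qed.

Lemma sub_fN_fS : fN_Fin `<=` fS_Fin.
Proof.
move=> F [S [finS FS]]; apply/fS_FinP.
have /choice[h hP] m :=
  finite_restriction_bound _ _ _ m (finS m.+1) (ltnSn m : `I_m.+1 m).
exists h => x /FS; apply: (@inf_often_relabel succn 1) => -[//|m] _ Sm.
by exists m => //; exact: hP.
Qed.

Lemma fS_Fin_proper : ~ fS_Fin setT.
Proof.
move=> /fS_FinP[h hP]; apply: (hP (fun m => (h m).+1) Logic.I).
rewrite (_ : [set _ | _] = set0) //.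
by apply/seteqP; split=> // m /=; rewrite ltnn.
Qed.

Lemma fN_Fin_sigma_ideal : sigma_ideal fN_Fin.
Proof.
split.
- by exists (fun=> set0); split.
- by move=> /sub_fN_fS; exact: fS_Fin_proper.
- by move=> A B AB [S [finS BS]]; exists S; split=> // x /AB /BS.
move=> A /choice[S SP].
exists (fun n => \bigcup_(i in `I_n.+1) S i n); split.
  move=> n; apply: bigcup_finite; first exact: finite_II.
  by move=> i _; have [] := SP i.
move=> x [i _ Aix]; have [_ /(_ x Aix)] := SP i.
by apply: (@inf_often_eventually i) => n lein Sn; exists i.
Qed.

Lemma fS_Fin_sigma_ideal : sigma_ideal fS_Fin.
Proof.
split.
- by apply/fS_FinP; exists (fun=> 0).
- exact: fS_Fin_proper.
- by move=> A B AB /fS_FinP[h Bh]; apply/fS_FinP; exists h => x /AB /Bh.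
move=> A AS.
have /choice[h hP] i := (fS_FinP (A i)).1 (AS i).
apply/fS_FinP; exists (fun m => \max_(i < m.+1) h i m) => x [i _ Aix].
move: (hP i x Aix); apply: (@inf_often_eventually i) => m leim xh.
apply: leq_trans xh _.
by apply: (leq_bigmax (Ordinal (leim : i < m.+1))).
Qed.

Theorem proposition9 :
  fN_Fin `<=` fS_Fin /\ sigma_ideal fN_Fin /\ sigma_ideal fS_Fin.
Proof.
exact: (conj sub_fN_fS (conj fN_Fin_sigma_ideal fS_Fin_sigma_ideal)).
Qed.
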